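(* Let $\mathcal H$ be a real Hilbert space and let $\Phi:\mathcal H\to\mathbb R$ be a convex differentiable function whose gradient $\nabla\Phi$ is Lipschitz continuous on bounded sets, and suppose that $\Phi$ is even, i.e. $\Phi(-x)=\Phi(x)$ for all $x\in\mathcal H$. Let $t_0>0$, $\alpha>3$, and let $g:[t_0,+\infty[\to\mathcal H$ satisfy $\int_{t_0}^{+\infty}t\|g(t)\|\,dt<+\infty$. Let $x:[t_0,+\infty[\to\mathcal H$ be a classical global solution of $$\ddot x(t)+\frac{\alpha}{t}\dot x(t)+\nabla\Phi(x(t))=g(t).$$ Then there exists some $\bar x\in\operatorname{argmin}\Phi$ such that $x(t)$ converges strongly (in norm) to $\bar x$ as $t\to+\infty$.
   Context: $\|\cdot\|$ is the norm of $\mathcal H$ associated with its scalar product. *)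

(* Defs.v *)
From mathcomp Require Export all_boot all_order all_algebra sesquilinear.
From mathcomp Require Export all_classical all_reals all_analysis.
Export numFieldNormedType.Exports.
Import Order.TTheory GRing.Theory Num.Theory.

Set Implicit Arguments.
Unset Strict Implicit.
Unset Printing Implicit Defensive.

Local Open Scope classical_set_scope.
Local Open Scope ring_scope.

(* A real Hilbert space is a complete normed module [H] with an inner product
   [ip : {dot H for idfun}] inducing its norm ([norm_from_dot ip]): over a real
   field, the conjugation of a hermitian form is the identity, so [ip] is a
   symmetric positive definite bilinear form. *)
Definition norm_from_dot (R : realType) (H : normedModType R)
    (ip : {dot H for (idfun : R -> R)}) : Prop :=
  forall u : H, ip u u = `|u| ^+ 2.

(* By Riesz representation, every Frechet differentiable [Phi] on a Hilbert
   space has exactly one such [G]. *)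
Definition is_gradient (R : realType) (H : normedModType R)
    (ip : {dot H for (idfun : R -> R)}) (Phi : H -> R) (G : H -> H) : Prop :=
  forall y : H, is_diff y Phi (fun h : H => ip (G y) h : R).

Definition lipschitz_on_bounded_sets (R : realType) (H : normedModType R)
    (G : H -> H) : Prop :=
  forall B : set H, bounded_set B -> [lipschitz G y | y in B].

Definition argmin (R : realType) (T : Type) (f : T -> R) : set T :=
  [set y | forall z : T, f y <= f z].

(* The derivative relative to [D]; for [D := `[t0, +oo[] it is the usual
   two-sided one at [t > t0] and the right derivative at [t0]. *)
Definition has_derive_within (R : realType) (H : normedModType R)
    (D : set R) (f : R -> H) (t : R) (l : H) : Prop :=
  (s - t)^-1 *: (f s - f t) @[s --> within D t^'] --> l.

(* Classical means of class C^2 on [t0, +oo[. The values of [x] and [g] below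
   [t0] play no role. *)
Definition classical_solution (R : realType) (H : normedModType R)
    (t0 alpha : R) (G : H -> H) (g x : R -> H) : Prop :=
  exists x' x'' : R -> H,
    [/\ forall t, t0 <= t -> has_derive_within `[t0, +oo[ x t (x' t),
        forall t, t0 <= t -> has_derive_within `[t0, +oo[ x' t (x'' t),
        {within `[t0, +oo[, continuous x''} &
        forall t, t0 <= t -> x'' t + (alpha / t) *: x' t + G (x t) = g t].

(* Main.v *)
Require Import Defs.
Import Order.TTheory GRing.Theory Num.Theory.
From mathcomp Require Import ring lra.

Set Implicit Arguments.
Unset Strict Implicit.
Unset Printing Implicit Defensive.

Local Open Scope classical_set_scope.
Local Open Scope ring_scope.

(* By evenness and convexity, 0 minimizes [Phi]; put phi = Phi o x - Phi 0 and
   v = (alpha - 1) x + t x'. The energy t^2 phi + |v|^2 / 2 bounds x and t x'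
   and makes t phi and then t |x'|^2 integrable; hence
   U = t^2 (|x'|^2 / 2 + phi) tends to 0.
   Multiplying the equation by t instead of t^alpha, every second-order
   inequality t q'' + alpha q' <= k integrates to a monotonicity statement for
   t q' + (alpha - 1) q - int k, with t q' small. For q = |x|^2 / 2 it shows
   that |x| converges. For s fixed and
   q(r) = |x(r)|^2 - |x(s)|^2 - |x(r) - x(s)|^2 / 2 one has
   q' = <x'(r), x(r) + x(s)>, and evenness enters through the gradient
   inequality between x(r) and - x(s),
   - <grad Phi(x(r)), x(r) + x(s)> <= phi(s) - phi(r).
   The term phi(s) integrates against r dr over [t, s] to at most U(s), so
   |x(t) - x(s)|^2 is small and x is Cauchy. *)

(** * Derivatives and inner products *)

Section derivative_rules.
Variables (R : realType) (V : normedModType R).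
Implicit Types (f g : R -> R) (u v : R -> V) (t : R).

Lemma is_derive_quotientP u t (l : V) :
  is_derive t 1 u l <-> h^-1 *: (u (h + t) - u t) @[h --> 0^'] --> l.
Proof.
have E : (fun h : R => h^-1 *: ((u \o shift t) (h *: 1) - u t)) =
         (fun h : R => h^-1 *: (u (h + t) - u t)).
  by apply/funext => h /=; rewrite [h *: 1]mulr1.
split=> [[] |].
  move=> /[swap] <-; rewrite /derivable /derive E.
  by move=> /cvg_ex[m hm]; rewrite (cvg_lim _ hm).
move=> ul; split; first by apply/cvg_ex; exists l; rewrite E.
by rewrite /derive E; exact: cvg_lim.
Qed.

Lemma is_derive_continuous u t (l : V) :
  is_derive t 1 u l -> {for t, continuous u}.
Proof. by case=> u' _; exact/differentiable_continuous/derivable1_diffP. Qed.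

Lemma is_derive_cvg_shift u t (l : V) :
  is_derive t 1 u l -> u (h + t) @[h --> 0^'] --> u t.
Proof.
move=> /is_derive_continuous; apply: cvg_comp => /=.
have : h + t @[h --> (0 : R)] --> 0 + t by apply: cvgD; [|exact: cvg_cst].
by rewrite add0r; apply: cvg_trans; exact: cvg_app (@nbhs_dnbhs _ _).
Qed.

End derivative_rules.

Section derivative_operations.
Variables (R : realType) (V : normedModType R).
Implicit Types (f g : R -> R) (u v : R -> V) (t : R).

Lemma is_derive_const (a : V) t : is_derive t 1 (fun=> a) (0 : V).
Proof. exact: is_derive_cst. Qed.

Lemma is_derive_plus u v t (du dv : V) : is_derive t 1 u du ->
  is_derive t 1 v dv -> is_derive t 1 (fun s => u s + v s) (du + dv).
Proof. exact: is_deriveD. Qed.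

Lemma is_derive_minus u v t (du dv : V) : is_derive t 1 u du ->
  is_derive t 1 v dv -> is_derive t 1 (fun s => u s - v s) (du - dv).
Proof. exact: is_deriveB. Qed.

Lemma is_derive_mult f g t (df dg : R) : is_derive t 1 f df ->
  is_derive t 1 g dg ->
  is_derive t 1 (fun s => f s * g s) (f t * dg + g t * df).
Proof. exact: is_deriveM. Qed.

Lemma is_derive_scale f u t (df : R) (du : V) : is_derive t 1 f df ->
  is_derive t 1 u du ->
  is_derive t 1 (fun s => f s *: u s) (f t *: du + df *: u t).
Proof.
move=> f' u'; apply/is_derive_quotientP.
have uc := is_derive_cvg_shift u'.
have -> : (fun h => h^-1 *: (f (h + t) *: u (h + t) - f t *: u t)) =
  (fun h => f t *: (h^-1 *: (u (h + t) - u t)) +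
            (h^-1 *: (f (h + t) - f t)) *: u (h + t)).
  apply/funext => h; rewrite scalerA mulrC -scalerA -scalerA -scalerDr.
  by congr (_ *: _); rewrite scalerBr scalerBl [RHS]addrC [RHS]addrA subrK.
apply: cvgD; apply: cvgZ => //; try exact: cvg_cst.
  exact: (is_derive_quotientP u t du).1.
exact: (@is_derive_quotientP R R^o f t df).1.
Qed.

End derivative_operations.

Section inner_product.
Variables (R : realType) (H : normedModType R).
Variable ip : {dot H for (idfun : R -> R)}.
Hypothesis ip_norm : norm_from_dot ip.
Implicit Types u v w : H.

Lemma ipC u v : ip u v = ip v u.
Proof. by rewrite hermC /= mul1r. Qed.

Lemma ipDl u v w : ip (u + v) w = ip u w + ip v w.
Proof. by rewrite linearDl. Qed.

Lemma ipDr u v w : ip w (u + v) = ip w u + ip w v.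
Proof. by rewrite linearDr. Qed.

Lemma ipBl u v w : ip (u - v) w = ip u w - ip v w.
Proof. by rewrite linearBl. Qed.

Lemma ipBr u v w : ip w (u - v) = ip w u - ip w v.
Proof. by rewrite linearBr. Qed.

Lemma ipZl (a : R) u w : ip (a *: u) w = a * ip u w.
Proof. by rewrite linearZl_LR. Qed.

Lemma ipZr (a : R) u w : ip w (a *: u) = a * ip w u.
Proof. by rewrite linearZr_LR. Qed.

Lemma ip_normD u v : `|u + v| ^+ 2 = `|u| ^+ 2 + 2 * ip u v + `|v| ^+ 2.
Proof. by rewrite -!ip_norm linearDl !linearDr /= (ipC v u); ring. Qed.

Lemma ip_normB u v : `|u - v| ^+ 2 = `|u| ^+ 2 - 2 * ip u v + `|v| ^+ 2.
Proof. by rewrite ip_normD normrN linearNr /=; ring. Qed.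

Lemma ip_le u v : ip u v <= `|u| * `|v|.
Proof.
have : `|u + v| ^+ 2 <= (`|u| + `|v|) ^+ 2.
  by rewrite ler_sqr ?nnegrE ?addr_ge0 ?ler_normD.
by rewrite ip_normD; lra.
Qed.

Lemma ip_ge u v : - (`|u| * `|v|) <= ip u v.
Proof. by have := ip_le (- u) v; rewrite linearNl normrN /=; lra. Qed.

(** Polarization writes the inner product through norms, so its joint continuity reduces to that of
    the norm. *)
Lemma ip_cvg T (F : set_system T) (FF : Filter F) (u v : T -> H) (a b : H) :
  u @ F --> a -> v @ F --> b -> ip (u s) (v s) @[s --> F] --> ip a b.
Proof.
move=> ua vb.
have E w z : ip w z = 4^-1 * (`|w + z| ^+ 2 - `|w - z| ^+ 2).
  by rewrite ip_normD ip_normB; field.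
rewrite E; under eq_fun do rewrite E.
apply: cvgM; first exact: cvg_cst.
by apply: cvgB; rewrite expr2; under eq_fun do rewrite expr2;
  apply: cvgM; apply: cvg_norm; first [exact: cvgD | exact: cvgB].
Qed.

Lemma is_derive_ip (u v : R -> H) (t : R) (du dv : H) :
  is_derive t 1 u du -> is_derive t 1 v dv ->
  is_derive t 1 (fun s => ip (u s) (v s)) (ip du (v t) + ip (u t) dv).
Proof.
move=> u' v'; apply/is_derive_quotientP.
have vc := is_derive_cvg_shift v'.
have -> : (fun h => h^-1 *: (ip (u (h + t)) (v (h + t)) - ip (u t) (v t))) =
  (fun h => ip (h^-1 *: (u (h + t) - u t)) (v (h + t)) +
            ip (u t) (h^-1 *: (v (h + t) - v t))).
  apply/funext => h; rewrite ipZl ipZr ipBl ipBr mulrBr [h^-1 *: _]mulrBr.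
  by rewrite mulrBr addrA subrK.
apply: cvgD; apply: ip_cvg => //; try exact: cvg_cst.
  exact: (is_derive_quotientP u t du).1.
exact: (is_derive_quotientP v t dv).1.
Qed.
End inner_product.

(** * Monotonicity, gradients and antiderivatives *)

Section monotone.
Variable R : realType.
Implicit Types (f df : R -> R) (a b e : R).

Lemma MVT_ray f df a s t : (forall r, a <= r -> is_derive r 1 f (df r)) ->
  a <= s -> s <= t -> exists2 c, s <= c <= t & f t - f s = df c * (t - s).
Proof.
move=> f' as_ st.
have f's r : r \in `[s, t] -> is_derive r 1 f (df r).
  by rewrite in_itv /= => /andP[sr _]; apply: f'; exact: le_trans sr.
have f'o r : r \in `]s, t[ -> is_derive r 1 f (df r).
  by move=> /subset_itv_oo_cc /f's.
have fc : {within `[s, t], continuous f}.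
  by apply: derivable_within_continuous => r /f's[].
have [c cst cE] := MVT_segment st f'o fc.
by exists c => //; move: cst; rewrite in_itv.
Qed.

(** The derivative is existential so that callers can let [is_derive_eq] compute it first and bound
    it afterwards. *)
Lemma is_derive_le0_nonincreasing f a :
  (forall r, a <= r -> exists2 d, is_derive r 1 f d & d <= 0) ->
  forall s t, a <= s -> s <= t -> f t <= f s.
Proof.
move=> f' s t as_ st; rewrite -subr_le0.
have f'D r : a <= r -> is_derive r 1 f ('D_1 f r).
  by move=> /f'[d [fr _] _]; exact: derivableP.
have [c /andP[sc _] ->] := MVT_ray f'D as_ st.
have [d [_ ->] d0] := f' _ (le_trans as_ sc).
by rewrite mulr_le0_ge0 ?subr_ge0.
Qed.

Lemma is_derive_ge0_nondecreasing f a :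
  (forall r, a <= r -> exists2 d, is_derive r 1 f d & 0 <= d) ->
  forall s t, a <= s -> s <= t -> f s <= f t.
Proof.
move=> f' s t as_ st; rewrite -lerN2.
apply: (@is_derive_le0_nonincreasing (fun r => - f r) a) as_ st => r.
move=> /f'[d fd d0].
by exists (- d); [exact: is_deriveN|rewrite oppr_le0].
Qed.

(** Cauchy form of monotone convergence: past a point where [f] is within [e] of its supremum, at
    most [e] is left to gain. *)
Lemma nondecreasing_bounded_increment f a b e :
  (forall s t, a <= s -> s <= t -> f s <= f t) ->
  (forall t, a <= t -> f t <= b) -> 0 < e ->
  \forall r \near +oo, forall s t, r <= s -> s <= t -> f t - f s <= e.
Proof.
move=> fnd fb e0.
have fsup : has_sup [set f t | t in `[a, +oo[].
  split; first by exists (f a), a; rewrite //= in_itv /= lexx.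
  by exists b => _ [t /= + <-]; rewrite in_itv /= andbT; exact: fb.
have [_ [c /=] + <-] := sup_adherent e0 fsup.
rewrite in_itv /= andbT => ac cl; near=> r.
have cr : c <= r by near: r; exact: nbhs_pinfty_ge (num_real c).
move=> s t /(le_trans cr) cs st.
have : f t <= sup [set f t | t in `[a, +oo[].
  apply: (sup_upper_bound fsup); exists t => //=.
  by rewrite in_itv /= andbT (le_trans ac) // (le_trans cs).
by have := fnd _ _ ac cs; lra.
Unshelve. all: by end_near. Qed.

Lemma near_pinfty_all_ge (A : set R) :
  (\forall t \near +oo, A t) ->
  \forall r \near +oo, forall t, r <= t -> A t.
Proof.
move=> [M [Mr hA]]; exists M; split=> // r Mr' t rt.
by apply: hA; exact: lt_le_trans rt.
Qed.

End monotone.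

Section gradient.
Variables (R : realType) (H : normedModType R).
Variable ip : {dot H for (idfun : R -> R)}.
Variables (Phi : H -> R) (G : H -> H).
Hypothesis Phi_grad : is_gradient ip Phi G.

Lemma is_derive_gradient (u : R -> H) (t : R) (du : H) :
  is_derive t 1 u du ->
  is_derive t 1 (fun s => Phi (u s)) (ip (G (u t)) du).
Proof.
move=> u'; have du_t : differentiable u t by apply/derivable1_diffP; case: u'.
have [dPhi PhiE] := Phi_grad (u t).
have dPu : differentiable (Phi \o u) t by exact: differentiable_comp.
split; first exact/derivable1_diffP.
have -> : (fun s => Phi (u s)) = Phi \o u by [].
rewrite deriveE // diff_comp //= PhiE -deriveE //.
by have [_ ->] := u'.
Qed.

(** By convexity the difference quotient of [Phi] from [y] towards [z] is at most [Phi z - Phi y]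
    for steps in ]0, 1]; its right limit at 0 is [ip (G y) (z - y)]. *)
Lemma convex_gradient_le (y z : H) :
  convex_function [set: convex_lmodType H] Phi ->
  Phi y + ip (G y) (z - y) <= Phi z.
Proof.
move=> cvx; rewrite -lerBrDl.
have : is_derive (0 : R) 1 (fun s : R => Phi (y + s *: (z - y)))
    (ip (G y) (z - y)).
  have : is_derive (0 : R) 1 (fun s : R => y + s *: (z - y)) (z - y).
    apply: is_derive_eq; first by apply: is_derive_plus; apply: is_derive_scale.
    by rewrite /= scaler0 scale1r !add0r.
  by move=> /is_derive_gradient /=; rewrite scale0r addr0.
move=> /is_derive_quotientP dF.
apply: (cvgr_to_le (F := 0^'+) (f := fun h : R =>
  h^-1 *: (Phi (y + (h + 0) *: (z - y)) - Phi (y + 0 *: (z - y))))).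
  apply: cvg_trans dF; apply: cvg_app => A [e e0 Ae]; exists e => // r re r0.
  by apply: Ae => //; exact/lt0r_neq0.
near=> h.
have h0 : 0 < h by near: h; exact: nbhs_right_gt.
have h1 : h <= 1 by near: h; exact: nbhs_right_le.
rewrite addr0 scale0r addr0 [_ *: _]mulrC ler_pdivrMr //.
have : Phi (h *: z + (1 - h) *: y) <= h * Phi z + (1 - h) * Phi y.
  by have := cvx (Itv01 (ltW h0) h1) z y; rewrite !inE; exact.
have -> : h *: z + (1 - h) *: y = y + h *: (z - y).
  by rewrite scalerBl scale1r scalerBr addrCA.
by lra.
Unshelve. all: by end_near. Qed.
End gradient.

Section antiderivative.
Variable R : realType.
Variables (f : R -> R) (a : R).
Hypothesis f_cont : forall t, a < t -> {for t, continuous f}.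
Local Notation mu := (@lebesgue_measure R).

(** Continuity is known only on the open ray, so the integral starts at some [b] beyond [a], which
    makes [f] integrable on a compact interval around [t]. *)
Lemma is_derive_Rintegral (b t : R) : a < b -> b < t ->
  is_derive t 1 (fun s => \int[mu]_(r in `[b, s]) f r) (f t).
Proof.
move=> ab bt.
have fint : mu.-integrable `[b, (t + 1)] (EFin \o f).
  apply: continuous_compact_integrable; first exact: segment_compact.
  apply: continuous_in_subspaceT => r; rewrite inE /= in_itv /= => /andP[br _].
  by apply: f_cont; exact: lt_le_trans br.
have tt1 : t < t + 1 by rewrite ltrDl.
have [Fd <-] := continuous_FTC1_closed tt1 fint bt (f_cont (lt_trans ab bt)).
by rewrite derive1E; exact: derivableP.
Qed.

Lemma exists_antiderivative (b : R) : a < b ->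
  exists F : R -> R, forall t, b < t -> is_derive t 1 F (f t).
Proof. by move=> ab; eexists => t; exact: is_derive_Rintegral. Qed.

Lemma exists_bounded_antiderivative (b : R) : a < b ->
  (forall t, a <= t -> 0 <= f t) ->
  (\int[mu]_(t in `[a, +oo[) (f t)%:E < +oo)%E ->
  exists F : R -> R, (forall t, b < t -> is_derive t 1 F (f t)) /\
    exists B, forall t, b < t -> F t <= B.
Proof.
move=> ab f0 fint; eexists; split => [t|]; first exact: is_derive_Rintegral.
have mf : measurable_fun `[a, +oo[ f.
  (* Adding the single point [a], where [f] may be discontinuous, preserves measurability. *)
  apply/measurable_realfun.measurable_fun_itv_obnd_cbndP.
  apply: measurable_realfun.open_continuous_measurable_fun => // t.
  by rewrite inE /= in_itv /= andbT; exact: f_cont.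
have f0' (t : R) : `[a, +oo[%classic t -> (0 <= (f t)%:E)%E.
  by rewrite /= in_itv /= andbT lee_fin; exact: f0.
have fin_a : (\int[mu]_(t in `[a, +oo[) (f t)%:E)%E \is a fin_num.
  by rewrite ge0_fin_numE //; exact: integral_ge0.
exists (fine (\int[mu]_(t in `[a, +oo[) (f t)%:E)%E) => t bt.
have sub : `[b, t] `<=` `[a, +oo[.
  by move=> r /=; rewrite !in_itv /= andbT => /andP[/(le_trans (ltW ab))].
have le_int : (\int[mu]_(r in `[b, t]) (f r)%:E <=
    \int[mu]_(r in `[a, +oo[) (f r)%:E)%E.
  apply: ge0_subset_integral => //.
  exact/measurable_realfun.measurable_EFinP.
apply: fine_le => //; rewrite ge0_fin_numE ?(le_lt_trans le_int) //.
by apply: integral_ge0 => r /sub; exact: f0'.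
Qed.

End antiderivative.

(** A neighbourhood of [t] lies inside the ray, so restricting the limit to the ray changes nothing
    there. *)
Lemma has_derive_within_interior (R : realType) (H : normedModType R)
    (t0 t : R) (u : R -> H) (l : H) : t0 < t ->
  has_derive_within `[t0, +oo[ u t l -> is_derive t 1 u l.
Proof.
move=> t0t u'; apply/is_derive_quotientP.
have E : (fun h : R => h^-1 *: (u (h + t) - u t)) =
    (fun s : R => (s - t)^-1 *: (u s - u t)) \o (fun h => h + t).
  by apply/funext => h /=; rewrite addrK.
rewrite E; apply: cvg_comp u' => A nA.
have {}nA : \forall s \near t, s != t -> A ((s - t)^-1 *: (u s - u t)).
  have : \forall s \near nbhs t, t0 < s.
    exact: (cvgr_gt _ (@cvg_id _ _) _ t0t).
  apply: filter_app; apply: (@filterS _ (nbhs t) _ _ _ _ nA) => s /= nAs.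
  move=> /ltW ts st.
  by apply: nAs => //; rewrite in_itv /= ts.
have ht : h + t @[h --> (0 : R)] --> t.
  have : h + t @[h --> (0 : R)] --> 0 + t by apply: cvgD; [|exact: cvg_cst].
  by rewrite add0r.
apply: (@filterS _ (nbhs (0 : R)) _ _ _ _ (ht _ nA)) => h /= hA h0; apply: hA.
by rewrite -subr_eq0 addrK.
Qed.

(** * Inertial trajectories *)

(* With these, [is_derive_eq] differentiates [fun s => ...] expressions by
   instance resolution. *)
#[local] Existing Instances
  is_derive_plus is_derive_minus is_derive_mult is_derive_scale.

Lemma scale_mulE (R : realType) (a b : R) : a *: (b : R^o) = a * b.
Proof. by []. Qed.

Section inertial_trajectory.
Variables (R : realType) (H : completeNormedModType R).
Variable ip : {dot H for (idfun : R -> R)}.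
Hypothesis ip_norm : norm_from_dot ip.
Variables (Phi : H -> R) (G : H -> H).
Hypothesis Phi_grad : is_gradient ip Phi G.
Hypothesis Phi_convex : convex_function [set: convex_lmodType H] Phi.
Hypothesis Phi_even : forall y, Phi (- y) = Phi y.

(** In the gradient inequalities from 0 to [y] and from 0 to [- y] the linear terms are opposite;
    adding them leaves the claim. *)
Lemma even_convex_min (y : H) : Phi 0 <= Phi y.
Proof.
have := convex_gradient_le Phi_grad 0 y Phi_convex.
have := convex_gradient_le Phi_grad 0 (- y) Phi_convex.
by rewrite Phi_even !subr0 linearNr /=; lra.
Qed.

(** Integrals enter only through antiderivatives, so integrability over the ray becomes an upper
    bound: assumed for [Gam], derived below for [P] and [Q]. *)
Variables (T alpha : R) (g x x' x'' : R -> H) (P Q Gam : R -> R) (BGam : R).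
Hypotheses (T_gt0 : 0 < T) (alpha_gt3 : 3 < alpha).
Hypothesis dx : forall t, T <= t -> is_derive t 1 x (x' t).
Hypothesis dx' : forall t, T <= t -> is_derive t 1 x' (x'' t).
Hypothesis ode : forall t, T <= t ->
  x'' t + (alpha / t) *: x' t + G (x t) = g t.
Hypothesis dP : forall t, T <= t -> is_derive t 1 P (t * (Phi (x t) - Phi 0)).
Hypothesis dQ : forall t, T <= t -> is_derive t 1 Q (t * ip (x' t) (x' t)).
Hypothesis dGam : forall t, T <= t -> is_derive t 1 Gam (t * `|g t|).
Hypothesis Gam_le : forall t, T <= t -> Gam t <= BGam.

Let phi t := Phi (x t) - Phi 0.
Let v t := (alpha - 1) *: x t + t *: x' t.

Let pos t : T <= t -> 0 < t. Proof. exact: lt_le_trans. Qed.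

Let phi_ge0 t : 0 <= phi t. Proof. by rewrite subr_ge0 even_convex_min. Qed.

Let ip_ge0 u : 0 <= ip u u. Proof. by rewrite ip_norm sqr_ge0. Qed.

Let ode_ip z t : T <= t ->
  t * ip z (x'' t) = t * ip z (g t) - t * ip z (G (x t)) - alpha * ip z (x' t).
Proof.
move=> Tt; rewrite -ode // !(ipDr, ipZr) //.
by field; rewrite gt_eqF // pos.
Qed.

Let dphi t : T <= t -> is_derive t 1 phi (ip (G (x t)) (x' t)).
Proof.
move=> Tt; have := is_derive_gradient Phi_grad (dx Tt) => ?.
by apply: is_derive_eq; rewrite subr0.
Qed.

(** The weight [alpha - 1] makes the velocity terms add up to [alpha *: x' t], so that acceleration
    and damping leave through the equation together. *)
Let dv t : T <= t -> is_derive t 1 v (t *: (g t - G (x t))).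
Proof.
move=> Tt; have := dx Tt; have := dx' Tt => ? ?.
apply: is_derive_eq; rewrite -ode // addrK scalerDr scalerA.
rewrite mulrC divfK ?gt_eqF ?pos //= addrCA -scalerDl.
by rewrite subrK.
Qed.

Let grad_x t : phi t <= ip (G (x t)) (x t).
Proof.
have := convex_gradient_le Phi_grad (x t) 0 Phi_convex.
by rewrite sub0r linearNr /= /phi; lra.
Qed.

(** * The energy [E] and the bounds it gives *)

Let E t := t * t * phi t + 2^-1 * ip (v t) (v t).

(** The two terms [t * t * ip (G (x t)) (x' t)], one from [phi] and one from [v], cancel. *)
Let dE t : T <= t -> is_derive t 1 E
  (2 * t * phi t - (alpha - 1) * t * ip (G (x t)) (x t) + t * ip (v t) (g t)).
Proof.
move=> Tt; have := dphi Tt; have := is_derive_ip ip_norm (dv Tt) (dv Tt) => ? ?.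
apply: is_derive_eq; rewrite !scale_mulE !(ipBl, ipBr, ipDl, ipDr, ipZl, ipZr).
by rewrite !(ipC _ (g t)) !(ipC _ (G (x t))); field.
Qed.

Let E_ge0 t : 0 <= E t.
Proof. by rewrite /E -expr2 addr_ge0 // mulr_ge0 // sqr_ge0. Qed.

(** This makes the forcing term at most linear in [1 + E], as Gronwall's argument requires. *)
Let norm_v_le t : `|v t| <= 1 + E t.
Proof.
have := sqr_ge0 (`|v t| - 1); have : 0 <= t ^+ 2 * phi t.
  by rewrite mulr_ge0 // sqr_ge0.
by rewrite /E ip_norm; lra.
Qed.

Let dGam_ge0 t : T <= t -> 0 <= t * `|g t|.
Proof. by move=> /pos/ltW ?; rewrite mulr_ge0. Qed.

(** By [grad_x], the coefficient of [t * phi t] becomes [2 - (alpha - 1)], which is negative exactly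
    when [alpha] exceeds 3. *)
Let dE_le t : T <= t ->
  2 * t * phi t - (alpha - 1) * t * ip (G (x t)) (x t) + t * ip (v t) (g t) <=
  - (alpha - 3) * (t * phi t) + t * `|g t| * `|v t|.
Proof.
move=> Tt; have t0 := pos Tt; have a3 := alpha_gt3.
have h1 : (alpha - 1) * t * phi t <= (alpha - 1) * t * ip (G (x t)) (x t).
  by apply: ler_wpM2l => //; rewrite mulr_ge0 ?(ltW t0) //; lra.
have h2 : t * ip (v t) (g t) <= t * (`|v t| * `|g t|).
  by rewrite ler_pM2l // ip_le.
lra.
Qed.

(** Gronwall's argument with integrating factor [expR (- Gam t)]: the product with [1 + E] is
    nonincreasing, and [Gam] is bounded above. *)
Let E_bounded : exists C : R, 0 <= C /\ forall t, T <= t -> E t <= C.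
Proof.
have a3 := alpha_gt3.
pose F t := (1 + E t) * expR (- Gam t).
pose dF t := expR (- Gam t) *
  (2 * t * phi t - (alpha - 1) * t * ip (G (x t)) (x t) + t * ip (v t) (g t)
   - (1 + E t) * (t * `|g t|)).
have F' t : T <= t -> is_derive t 1 F (dF t).
  move=> Tt; have := dE Tt; have := dGam Tt => ? ?.
  have ? : is_derive t 1 (fun s => expR (- Gam s))
      (expR (- Gam t) * - (t * `|g t|)).
    exact: is_derive1_comp.
  by apply: is_derive_eq; rewrite !scale_mulE /dF; ring.
have /is_derive_le0_nonincreasing F_le r : T <= r ->
    exists2 d, is_derive r 1 F d & d <= 0.
  move=> Tr; exists (dF r); first exact: F'.
  rewrite mulr_ge0_le0 ?expR_ge0 // subr_le0 (le_trans (dE_le Tr)) //.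
  have := ler_wpM2l (dGam_ge0 Tr) (norm_v_le r).
  have : 0 <= (alpha - 3) * (r * phi r).
    by rewrite !mulr_ge0 ?(ltW (pos Tr)) //; lra.
  lra.
have F0 : 0 <= F T by rewrite mulr_ge0 ?expR_ge0 // addr_ge0.
exists (F T * expR BGam); split; first by rewrite mulr_ge0 ?expR_ge0.
move=> t Tt; have := F_le _ _ (lexx T) Tt; rewrite {1}/F expRN.
rewrite ler_pdivrMr ?expR_gt0 //.
have : F T * expR (Gam t) <= F T * expR BGam.
  by rewrite ler_wpM2l // ler_expR Gam_le.
lra.
Qed.

Let v_bounded : exists C : R, 0 <= C /\ forall t, T <= t -> `|v t| <= C.
Proof.
have [C [C0 EC]] := E_bounded; exists (1 + C); split; first by lra.
by move=> t /EC; have := norm_v_le t; lra.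
Qed.

(** Once [v] is bounded by [C], integrating [dE_le] bounds [(alpha - 3) * P], because [E] is
    nonnegative. *)
Let P_bounded : exists B, forall t, T <= t -> P t <= B.
Proof.
have a3 := alpha_gt3.
have [C [C0 vC]] := v_bounded.
pose F t := E t + (alpha - 3) * P t - C * Gam t.
have /is_derive_le0_nonincreasing F_le r : T <= r ->
    exists2 d, is_derive r 1 F d & d <= 0.
  move=> Tr.
  have := dE Tr; have := dGam Tr; have := dP Tr => ? ? ?.
  eexists; first exact: is_derive_eq.
  rewrite /= !scale_mulE -/(phi r); have := dE_le Tr.
  have := ler_wpM2l (dGam_ge0 Tr) (vC _ Tr).
  lra.
exists ((F T + C * BGam) / (alpha - 3)) => t Tt.
rewrite ler_pdivlMr; last by lra.
have := F_le _ _ (lexx T) Tt; have := E_ge0 t; have := ler_wpM2l C0 (Gam_le Tt).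
by rewrite /F; lra.
Qed.

(** Expressing [t *: x'] through [v], the derivative of t |x|^2 is 2 <x, v> - (2 alpha - 3) |x|^2;
    since 2 <x, v> is at most |x|^2 + |v|^2, it is at most C^2. *)
Let x_bounded : exists M : R, 0 <= M /\ forall t, T <= t -> `|x t| <= M.
Proof.
have a3 := alpha_gt3.
have [C [C0 vC]] := v_bounded.
pose F t := t * ip (x t) (x t) - C ^+ 2 * t.
have /is_derive_le0_nonincreasing F_le r : T <= r ->
    exists2 d, is_derive r 1 F d & d <= 0.
  move=> Tr.
  have := is_derive_ip ip_norm (dx Tr) (dx Tr) => ?.
  eexists; first exact: is_derive_eq.
  have : ip (v r) (v r) <= C ^+ 2.
    by rewrite ip_norm ler_sqr ?nnegrE // vC.
  have : 0 <= ip (x r - v r) (x r - v r) by [].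
  have : ip (x r) (v r) = (alpha - 1) * ip (x r) (x r) + r * ip (x r) (x' r).
    by rewrite ipDr !ipZr.
  have : 0 <= (alpha - 3) * ip (x r) (x r) by rewrite mulr_ge0 //; lra.
  rewrite /= !scale_mulE ipBl !ipBr (ipC ip (x' r)) (ipC ip (v r) (x r)).
  have := ip_ge0 (x r).
  lra.
(* Monotonicity of [F] gives t |x t|^2 <= T |x T|^2 + C^2 (t - T), hence at most t K. *)
pose K := ip (x T) (x T) + C ^+ 2.
have K0 : 0 <= K by rewrite addr_ge0 // sqr_ge0.
exists (1 + K); split=> [|t Tt]; first by lra.
have : ip (x t) (x t) <= K.
  rewrite -(ler_pM2l (pos Tt)); have := F_le _ _ (lexx T) Tt.
  have := ler_wpM2r (ip_ge0 (x T)) Tt.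
  have := mulr_ge0 (ltW T_gt0) (sqr_ge0 C).
  by rewrite /F /K; lra.
by rewrite ip_norm; have := sqr_ge0 (`|x t| - 1); nra.
Qed.


Let x'_bounded : exists D : R, 0 <= D /\ forall t, T <= t -> t * `|x' t| <= D.
Proof.
have a3 := alpha_gt3.
have [C [C0 vC]] := v_bounded; have [M [M0 xM]] := x_bounded.
exists (C + (alpha - 1) * M); split=> [|t Tt].
  by rewrite addr_ge0 // mulr_ge0 //; lra.
have -> : t * `|x' t| = `|v t - (alpha - 1) *: x t|.
  by rewrite addrAC subrr add0r normrZ gtr0_norm // pos.
apply: le_trans (ler_normB _ _) _; apply: lerD; first exact: vC.
by rewrite normrZ ger0_norm ?ler_wpM2l ?xM //; lra.
Qed.

(** * Decay of the rescaled mechanical energy *)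

Let U t := t * t * (2^-1 * ip (x' t) (x' t) + phi t).

Let U_ge0 t : 0 <= U t.
Proof. by rewrite /U -expr2 mulr_ge0 ?sqr_ge0 // addr_ge0 // mulr_ge0. Qed.

(** Testing the equation against [x'] cancels the gradient terms; damping turns the coefficient of t
    |x'|^2 from 1 into [1 - alpha]. *)
Let dU t : T <= t -> is_derive t 1 U
  (2 * (t * phi t) + (1 - alpha) * (t * ip (x' t) (x' t))
   + t * (t * ip (x' t) (g t))).
Proof.
move=> Tt.
have := dphi Tt; have := is_derive_ip ip_norm (dx' Tt) (dx' Tt) => ? ?.
apply: is_derive_eq; rewrite /= !scale_mulE (ipC ip (x'' t)).
by have := congr1 ( *%R t) (ode_ip (x' t) Tt); rewrite (ipC ip _ (G _)); lra.
Qed.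

(** The antiderivatives compensate the terms of [dU]; [D] bounds t |x'|, so the forcing term is at
    most [D * (t * |g t|)]. *)
Let U_nonincreasing : exists D : R, 0 <= D /\ forall s t, T <= s -> s <= t ->
  U t - 2 * P t + (alpha - 1) * Q t - D * Gam t <=
  U s - 2 * P s + (alpha - 1) * Q s - D * Gam s.
Proof.
have [D [D0 xD]] := x'_bounded; exists D; split=> //.
pose F t := U t - 2 * P t + (alpha - 1) * Q t - D * Gam t.
apply: (is_derive_le0_nonincreasing (f := F)) => r Tr.
  have := dU Tr; have := dP Tr; have := dQ Tr; have := dGam Tr => ? ? ? ?.
  eexists; first exact: is_derive_eq.
rewrite /= !scale_mulE -/(phi r).
have : r * (r * ip (x' r) (g r)) <= D * (r * `|g r|).
  apply: (@le_trans _ _ (r * (r * (`|x' r| * `|g r|)))).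
    by rewrite !ler_pM2l ?pos // ip_le.
  have := ler_wpM2r (dGam_ge0 Tr) (xD _ Tr); lra.
lra.
Qed.

(** In [U_nonincreasing] everything except [(alpha - 1) * Q] is now bounded below, [U] being
    nonnegative. *)
Let Q_bounded : exists B, forall t, T <= t -> Q t <= B.
Proof.
have a3 := alpha_gt3.
have [D [D0 Udec]] := U_nonincreasing; have [B PB] := P_bounded.
exists ((U T - 2 * P T + (alpha - 1) * Q T - D * Gam T + 2 * B + D * BGam)
  / (alpha - 1)) => t Tt.
rewrite ler_pdivlMr; last by lra.
have := Udec _ _ (lexx _) Tt; have := PB _ Tt; have := U_ge0 t.
by have := ler_wpM2l D0 (Gam_le Tt); lra.
Qed.

Let P_nondecreasing s t : T <= s -> s <= t -> P s <= P t.
Proof.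
apply: is_derive_ge0_nondecreasing => r Tr; eexists; first exact: dP.
by rewrite -/(phi r) mulr_ge0 // ltW // pos.
Qed.

Let Q_nondecreasing s t : T <= s -> s <= t -> Q s <= Q t.
Proof.
apply: is_derive_ge0_nondecreasing => r Tr; eexists; first exact: dQ.
by rewrite mulr_ge0 // ltW // pos.
Qed.

Let Gam_nondecreasing s t : T <= s -> s <= t -> Gam s <= Gam t.
Proof.
apply: is_derive_ge0_nondecreasing => r Tr; eexists; first exact: dGam.
exact: dGam_ge0.
Qed.

Let P_increment (e : R) : 0 < e ->
  \forall r \near +oo, forall s t, r <= s -> s <= t -> P t - P s <= e.
Proof.
by have [B PB] := P_bounded; apply: nondecreasing_bounded_increment PB.
Qed.

Let Q_increment (e : R) : 0 < e ->
  \forall r \near +oo, forall s t, r <= s -> s <= t -> Q t - Q s <= e.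
Proof.
by have [B QB] := Q_bounded; apply: nondecreasing_bounded_increment QB.
Qed.

Let Gam_increment (e : R) : 0 < e ->
  \forall r \near +oo, forall s t, r <= s -> s <= t -> Gam t - Gam s <= e.
Proof. exact: nondecreasing_bounded_increment Gam_nondecreasing Gam_le. Qed.

Let near_ge (a : R) : \forall r \near +oo, a <= r.
Proof. exact: nbhs_pinfty_ge (num_real a). Qed.

(* [P + Q / 2] has derivative [U t / t], so the mean value theorem on [[r, 2 r]]
   yields a time [c] at which [U] is small; afterwards [U] barely increases. *)
Let U_small (e : R) : 0 < e -> \forall t \near +oo, U t <= e.
Proof.
move=> e0; have a3 := alpha_gt3; have [D [D0 Udec]] := U_nonincreasing.
(* [U c] costs 3 d, as c <= 2 r doubles the increment d + d / 2 of P + Q / 2; afterwards [P] costs 2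
   d and [Gam] costs D d. *)
pose d := e / (5 + D).
have d0 : 0 < d by rewrite divr_gt0 // ltr_wpDr.
have de : (5 + D) * d = e by rewrite /d mulrC divfK // gt_eqF // ltr_wpDr.
have [r [Tr [Pr [Qr Gr]]]] : exists r, T <= r /\
  (forall s t, r <= s -> s <= t -> P t - P s <= d) /\
  (forall s t, r <= s -> s <= t -> Q t - Q s <= d) /\
  (forall s t, r <= s -> s <= t -> Gam t - Gam s <= d).
  near (pinfty_nbhs R) => r; exists r; split; first by near: r; exact: near_ge.
  split; first by near: r; exact: P_increment.
  by split; near: r; [exact: Q_increment|exact: Gam_increment].
have r0 := pos Tr; have r2 : r <= r + r by rewrite lerDl ltW.
have PQ' u : T <= u -> is_derive u 1 (fun s => P s + 2^-1 * Q s)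
    (u * (2^-1 * ip (x' u) (x' u) + phi u)).
  move=> Tu; have := dP Tu; have := dQ Tu => ? ?.
  by apply: is_derive_eq; rewrite scale_mulE /phi; ring.
have [c /andP[rc cr] cE] := MVT_ray PQ' Tr r2.
have Uc : U c <= 3 * d.
  have : 0 <= c * (2^-1 * ip (x' c) (x' c) + phi c).
    by rewrite mulr_ge0 ?(le_trans (ltW r0) rc) // addr_ge0 // mulr_ge0.
  move=> /(ler_wpM2r) /(_ _ _ cr).
  have := Pr _ _ (lexx _) r2; have := Qr _ _ (lexx _) r2; rewrite /U; lra.
near=> t.
have ct : c <= t by near: t; exact: near_ge.
have Tc := le_trans Tr rc.
have := Udec _ _ Tc ct; have := Pr _ _ rc ct; have := Q_nondecreasing Tc ct.
rewrite -subr_ge0 => /(mulr_ge0 (_ : 0 <= alpha - 1)).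
have a1 : 0 <= alpha - 1 by lra.
move=> /(_ a1); have := ler_wpM2l D0 (Gr _ _ rc ct).
lra.
Unshelve. all: by end_near. Qed.

Let x'_small (e : R) : 0 < e -> \forall t \near +oo, t * `|x' t| <= e.
Proof.
move=> e0; near=> t.
have t0 : 0 <= t by near: t; exact: near_ge.
rewrite -ler_sqr ?nnegrE ?mulr_ge0 ?(ltW e0) //.
have : U t <= 2^-1 * e ^+ 2.
  by near: t; apply: U_small; rewrite mulr_gt0 // exprn_gt0.
have : 0 <= t * t * phi t by rewrite mulr_ge0 // mulr_ge0.
by rewrite /U ip_norm; lra.
Unshelve. all: by end_near. Qed.

(** * The Cauchy property of the trajectory *)

Let norm_x_decrement (e : R) : 0 < e ->
  \forall r \near +oo, forall s t, r <= s -> s <= t ->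
  (alpha - 1) / 2 * (ip (x s) (x s) - ip (x t) (x t)) <= e.
Proof.
move=> e0; have a3 := alpha_gt3; have [M [M0 xM]] := x_bounded.
have [D [D0 xD]] := x'_bounded; have [B QB] := Q_bounded.
(* By the equation, [F] has derivative M t |g| - t <x, g> + t <grad Phi(x), x>, which is
   nonnegative. Only decreases of |x|^2 are bounded, the half that [even_comparison] calls for. *)
pose F t := Q t + M * Gam t - (alpha - 1) / 2 * ip (x t) (x t)
  - t * ip (x' t) (x t).
have /is_derive_ge0_nondecreasing F_nd r : T <= r ->
    exists2 d, is_derive r 1 F d & 0 <= d.
  move=> Tr.
  have := dQ Tr; have := dGam Tr; have := is_derive_ip ip_norm (dx Tr) (dx Tr).
  have := is_derive_ip ip_norm (dx' Tr) (dx Tr) => ? ? ? ?.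
  eexists; first exact: is_derive_eq.
  rewrite /= !scale_mulE (ipC ip (x'' r)) (ipC ip (x' r) (x r)).
  have := ode_ip (x r) Tr; rewrite (ipC ip _ (G _)).
  have : r * ip (x r) (g r) <= r * `|g r| * M.
    apply: le_trans (ler_wpM2l (dGam_ge0 Tr) (xM _ Tr)).
    by rewrite -mulrA ler_pM2l ?pos // mulrC ip_le.
  have : 0 <= r * ip (G (x r)) (x r).
    by rewrite mulr_ge0 ?(ltW (pos Tr)) // (le_trans (phi_ge0 r)).
  lra.
have F_le t : T <= t -> F t <= B + M * BGam + D * M.
  move=> Tt; have := QB _ Tt; have := ler_wpM2l M0 (Gam_le Tt).
  have : 0 <= (alpha - 1) / 2 * ip (x t) (x t) by rewrite mulr_ge0 //; lra.
  have := ler_wpM2l (ltW (pos Tt)) (ip_ge ip_norm (x' t) (x t)).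
  have : t * (`|x' t| * `|x t|) <= D * M.
    by rewrite mulrA ler_pM ?xD ?xM // mulr_ge0 // ltW // pos.
  by rewrite /F; lra.
(* The increment of [F] costs d, and the boundary terms t <x', x> at [s] and at [t] cost M d
   each. *)
pose d := e / (1 + 2 * M).
have d0 : 0 < d by rewrite divr_gt0 // ltr_wpDr // mulr_ge0.
have de : (1 + 2 * M) * d = e.
  by rewrite /d mulrC divfK // gt_eqF // ltr_wpDr // mulr_ge0.
near=> r.
have Tr : T <= r by near: r; exact: near_ge.
have F_incr : forall s t, r <= s -> s <= t -> F t - F s <= d.
  by near: r; exact: nondecreasing_bounded_increment F_nd F_le d0.
have x'_d : forall t, r <= t -> t * `|x' t| <= d.
  by near: r; apply: near_pinfty_all_ge; exact: x'_small.
have x'x t : r <= t -> t * (`|x' t| * `|x t|) <= d * M.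
  move=> rt; have Tt := le_trans Tr rt.
  by rewrite mulrA ler_pM ?x'_d ?xM // mulr_ge0 // ltW // pos.
move=> s t rs st; have rt := le_trans rs st.
have Ts := le_trans Tr rs; have Tt := le_trans Tr rt.
have := F_incr _ _ rs st; have := Q_nondecreasing Ts st.
have := ler_wpM2l M0 (Gam_nondecreasing Ts st).
have := ler_wpM2l (ltW (pos Ts)) (ip_ge ip_norm (x' s) (x s)).
have := ler_wpM2l (ltW (pos Tt)) (ip_le ip_norm (x' t) (x t)).
have := x'x _ rs; have := x'x _ rt.
by rewrite /F; lra.
Unshelve. all: by end_near. Qed.

(* The term [phi t * r ^ 2 / 2] in [F] absorbs [Phi (x t) - Phi (x r)], which
   bounds [- ip (G (x r)) (x r + x t)] since [Phi (- x t) = Phi (x t)]. *)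
Let even_comparison s t : T <= s -> s <= t -> forall M, 0 <= M ->
  (forall r, T <= r -> `|x r| <= M) ->
  (alpha - 1) / 2 * ip (x s - x t) (x s - x t) <=
  (alpha - 1) * (ip (x s) (x s) - ip (x t) (x t)) + (Q t - Q s)
  + 2 * M * (Gam t - Gam s) + U t
  + 2 * M * (s * `|x' s|) + 2 * M * (t * `|x' t|).
Proof.
move=> Ts st M M0 xM; have Tt := le_trans Ts st.
have xx r : T <= r -> `|x r + x t| <= 2 * M.
  move=> Tr; rewrite (le_trans (ler_normD _ _)) //.
  by have := xM _ Tr; have := xM _ Tt; lra.
pose F r := r * ip (x' r) (x r + x t)
  + (alpha - 1) * (ip (x r) (x r) - 2^-1 * ip (x r - x t) (x r - x t))
  - Q r - 2 * M * Gam r - 2^-1 * phi t * (r * r).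
have /is_derive_le0_nonincreasing F_le r : T <= r ->
    exists2 d, is_derive r 1 F d & d <= 0.
  move=> Tr.
  have dxp : is_derive r 1 (fun s => x s + x t) (x' r).
    by have := dx Tr => ?; apply: is_derive_eq; rewrite addr0.
  have dxm : is_derive r 1 (fun s => x s - x t) (x' r).
    by have := dx Tr => ?; apply: is_derive_eq; rewrite subr0.
  have := dQ Tr; have := dGam Tr; have := is_derive_ip ip_norm (dx Tr) (dx Tr).
  have := is_derive_ip ip_norm (dx' Tr) dxp.
  have := is_derive_ip ip_norm dxm dxm => ? ? ? ? ?.
  eexists; first exact: is_derive_eq.
  have := ode_ip (x r + x t) Tr; rewrite (ipC ip _ (G _)).
  have h1 : r * ip (x r + x t) (g r) <= r * `|g r| * (2 * M).
    apply: le_trans (ler_wpM2l (dGam_ge0 Tr) (xx _ Tr)).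
    by rewrite -mulrA ler_pM2l ?pos // mulrC ip_le.
  have h2 : r * (phi r - ip (G (x r)) (x r + x t)) <= r * phi t.
    rewrite ler_pM2l ?pos //.
    have := convex_gradient_le Phi_grad (x r) (- x t) Phi_convex.
    by rewrite Phi_even -opprD linearNr /= (addrC (x t)) /phi; lra.
  have h3 : 0 <= r * phi r by rewrite mulr_ge0 // ltW // pos.
  have h4 : ip (x r + x t) (x' r) = ip (x r) (x' r) + ip (x t) (x' r).
    exact: ipDl.
  rewrite /= !scale_mulE !(ipC ip (x'' r)) !(ipC ip (x' r)) ipBl !h4.
  lra.
(* At r = t the squared distance vanishes. What remains of the absorbing term, phi(t) (t^2 - s^2) /
   2, is at most [U t]. *)
have := F_le _ _ Ts st; rewrite /F subrr linear0r /=.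
have h1 r : T <= r -> r * (`|x' r| * `|x r + x t|) <= r * `|x' r| * (2 * M).
  by move=> Tr; rewrite [leLHS]mulrA ler_wpM2l ?xx // mulr_ge0 // ltW // pos.
have := h1 _ Ts; have := h1 _ Tt.
have := ler_wpM2l (ltW (pos Tt)) (ip_ge ip_norm (x' t) (x t + x t)).
have := ler_wpM2l (ltW (pos Ts)) (ip_le ip_norm (x' s) (x s + x t)).
have : 0 <= t * t * ip (x' t) (x' t) by rewrite -expr2 mulr_ge0 // sqr_ge0.
have : 0 <= phi t * (s * s) by rewrite -expr2 mulr_ge0 // sqr_ge0.
have : 0 <= phi t * (t * t) by rewrite -expr2 mulr_ge0 // sqr_ge0.
by rewrite /U; lra.
Qed.

Let x_cauchy (e : R) : 0 < e ->
  \forall r \near +oo, forall s t, r <= s -> s <= t -> `|x s - x t| <= e.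
Proof.
move=> e0; have a3 := alpha_gt3; have [M [M0 xM]] := x_bounded.
(* In [even_comparison] the norms cost 2 d, [Q] and [U] cost d each, and [Gam] and the two velocity
   terms cost 2 M d each. *)
pose d := e ^+ 2 / (4 + 6 * M).
have M60 : 0 < 4 + 6 * M by lra.
have d0 : 0 < d by rewrite divr_gt0 // exprn_gt0.
have de : (4 + 6 * M) * d = e ^+ 2 by rewrite /d mulrC divfK // gt_eqF.
near=> r.
have Tr : T <= r by near: r; exact: near_ge.
have xd : forall s t, r <= s -> s <= t ->
  (alpha - 1) / 2 * (ip (x s) (x s) - ip (x t) (x t)) <= d.
  by near: r; exact: norm_x_decrement.
have Qd : forall s t, r <= s -> s <= t -> Q t - Q s <= d.
  by near: r; exact: Q_increment.
have Gd : forall s t, r <= s -> s <= t -> Gam t - Gam s <= d.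
  by near: r; exact: Gam_increment.
have Ud : forall t, r <= t -> U t <= d.
  by near: r; apply: near_pinfty_all_ge; exact: U_small.
have x'd : forall t, r <= t -> t * `|x' t| <= d.
  by near: r; apply: near_pinfty_all_ge; exact: x'_small.
move=> s t rs st; have rt := le_trans rs st.
rewrite -ler_sqr ?nnegrE ?(ltW e0) // -ip_norm.
have := even_comparison (le_trans Tr rs) st M0 xM.
(* The factor (alpha - 1) / 2 on the left of [even_comparison] is at least 1. *)
have : 0 <= (alpha - 3) * ip (x s - x t) (x s - x t).
  by rewrite mulr_ge0 //; lra.
have := xd _ _ rs st; have := Qd _ _ rs st; have := Ud _ rt.
have := ler_wpM2l M0 (Gd _ _ rs st).
have := ler_wpM2l M0 (x'd _ rs); have := ler_wpM2l M0 (x'd _ rt).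
lra.
Unshelve. all: by end_near. Qed.

Let x_minimizing (e : R) : 0 < e ->
  \forall t \near +oo, Phi (x t) <= Phi 0 + e.
Proof.
move=> e0; near=> t.
have t1 : 1 <= t by near: t; exact: near_ge.
have Ue : U t <= e by near: t; exact: U_small.
rewrite -lerBlDl -/(phi t) (le_trans _ Ue) // /U.
have tt : 1 <= t * t by rewrite -expr2 exprn_ege1.
have : 0 <= t * t * (2^-1 * ip (x' t) (x' t)).
  by rewrite mulr_ge0 ?(le_trans _ tt) // mulr_ge0.
by have := ler_wpM2r (phi_ge0 t) tt; lra.
Unshelve. all: by end_near. Qed.

Lemma inertial_trajectory_cvg :
  exists2 xbar : H, argmin Phi xbar & x t @[t --> +oo] --> xbar.
Proof.
have x_cvg : cvg (x t @[t --> +oo]).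
  apply: cauchy_cvg; apply: cauchy_exP => e e0.
  near (pinfty_nbhs R) => r; exists (x r).
  have x_r : forall s t, r <= s -> s <= t -> `|x s - x t| <= e / 2.
    by near: r; apply: x_cauchy; rewrite divr_gt0.
  suff : \forall t \near +oo, ball (x r) e (x t) by [].
  near=> t; have rt : r <= t by near: t; exact: near_ge.
  rewrite -ball_normE /ball_ /= (le_lt_trans (x_r _ _ (lexx r) rt)) //.
  by rewrite ltr_pdivrMr // ltr_pMr // ltr1n.
exists (lim (x t @[t --> +oo])) => // z.
(* Since 0 is a minimizer, it suffices that [Phi] at the limit is at most [Phi 0 + e] for every
   positive [e]; this passes to the limit by continuity of [Phi]. *)
apply: le_trans (even_convex_min z); apply/ler_addgt0Pr => e e0.
apply: (cvgr_to_le _ (x_minimizing e0)).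
have Phi_c : {for lim (x t @[t --> +oo]), continuous Phi}.
  have [Phi_d _] := Phi_grad (lim (x t @[t --> +oo])).
  exact: differentiable_continuous.
exact: continuous_cvg.
Unshelve. all: by end_near. Qed.

End inertial_trajectory.

(** * From classical solutions to inertial trajectories *)

Lemma lipschitz_on_bounded_sets_continuous (R : realType) (H : normedModType R)
  (G : H -> H) : lipschitz_on_bounded_sets G -> continuous G.
Proof.
move=> G_lip y.
have : bounded_set (ball y 1).
  exists (`|y| + 1); split=> [|M yM z]; first exact: num_real.
  rewrite -ball_normE /ball_ /= => yz; rewrite -(subKr y z).
  by apply: le_trans (ler_normB _ _) _; lra.
move=> /G_lip [k [_ /(_ (`|k| + 1))]].
(* The Lipschitz estimate holds for every constant above [k]; this one is also positive, so it can
   be divided by. *)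
have k1 : k < `|k| + 1 by rewrite ltr_pwDr // ler_norm.
set K := `|k| + 1 in k1 *; have K0 : 0 < K by rewrite ltr_wpDl.
move=> /(_ k1) GK; apply/cvgrPdist_le => e e0; near=> z.
have zy : ball y 1 z by near: z; exact: nbhsx_ballx.
apply: le_trans (GK (y, z) _) _ => /=.
  by split => //; exact: ballxx.
rewrite -ler_pdivlMl //; near: z.
have := @cvgrPdist_le _ _ _ (nbhs y) _ (@id H) y.
move=> [+ _]; apply => //; by rewrite mulr_gt0 // invr_gt0.
Unshelve. all: by end_near. Qed.

Theorem theorem3p3 (R : realType) (H : completeNormedModType R)
    (ip : {dot H for (idfun : R -> R)}) (Hip : norm_from_dot ip)
    (Phi : H -> R) (gradPhi : H -> H)
    (Phi_convex : convex_function [set: convex_lmodType H] Phi)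
    (Phi_grad : is_gradient ip Phi gradPhi)
    (grad_lip : lipschitz_on_bounded_sets gradPhi)
    (Phi_even : forall y : H, Phi (- y) = Phi y)
    (t0 alpha : R) (t0_gt0 : 0 < t0) (alpha_gt3 : 3 < alpha)
    (g : R -> H)
    (g_int : (\int[@lebesgue_measure R]_(t in `[t0, +oo[)
                (t * `|g t|)%:E < +oo)%E)
    (x : R -> H) (x_sol : classical_solution t0 alpha gradPhi g x) :
  exists2 xbar : H, argmin Phi xbar & x t @[t --> +oo] --> xbar.
Proof.
have [x' [x'' [x_x' x'_x'' x''_cont ode]]] := x_sol.
have dx t : t0 < t -> is_derive t 1 x (x' t).
  by move=> t0t; apply: has_derive_within_interior (x_x' _ (ltW t0t)).
have dx' t : t0 < t -> is_derive t 1 x' (x'' t).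
  by move=> t0t; apply: has_derive_within_interior (x'_x'' _ (ltW t0t)).
have cx'' t : t0 < t -> {for t, continuous x''}.
  move=> t0t; have : {within `]t0, +oo[, continuous x''}.
    apply: continuous_subspaceW x''_cont => s /=; rewrite !in_itv /= !andbT.
    exact: ltW.
  by rewrite continuous_open_subspace //; apply; rewrite inE /= in_itv /= t0t.
(* On [t0, +oo[ this equals [g]; written through the solution it is visibly continuous on ]t0, +oo[,
   so t |g| gets an antiderivative. *)
pose f (t : R) : H := x'' t + (alpha / t) *: x' t + gradPhi (x t).
have f_cont t : t0 < t -> {for t, continuous (fun s : R => s * `|f s|)}.
  move=> t0t; apply: cvgM; first exact: cvg_id.
  apply: cvg_norm; apply: cvgD; first apply: cvgD.
  - exact: cx''.
  - apply: cvgZ; last exact: is_derive_continuous (dx' t t0t).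
    apply: cvgM; first exact: cvg_cst.
    apply: cvgV; last exact: cvg_id.
    by rewrite gt_eqF // (lt_trans t0_gt0).
  - apply: continuous_cvg; last exact: is_derive_continuous (dx t t0t).
    exact: lipschitz_on_bounded_sets_continuous.
have f_ge0 t : t0 <= t -> 0 <= t * `|f t|.
  by move=> t0t; rewrite mulr_ge0 // (le_trans (ltW t0_gt0)).
have f_int : (\int[@lebesgue_measure R]_(t in `[t0, +oo[)
    (t * `|f t|)%:E < +oo)%E.
  rewrite (le_lt_trans _ g_int) // le_eqVlt; apply/orP; left; apply/eqP.
  by apply: eq_integral => t; rewrite inE /= in_itv /= andbT /f => /ode ->.
have t01 : t0 < t0 + 1 by rewrite ltrDl.
have [Gam [dGam [B GamB]]] :=
  exists_bounded_antiderivative f_cont t01 f_ge0 f_int.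
have phi_cont t : t0 < t ->
    {for t, continuous (fun s : R => s * (Phi (x s) - Phi 0))}.
  move=> t0t; have Phi_x' := is_derive_gradient Phi_grad (dx t t0t).
  have ? := is_derive_minus Phi_x' (is_derive_const (Phi 0) t).
  exact: is_derive_continuous (is_derive_mult (is_derive_id _ _) _).
have [P dP] := exists_antiderivative phi_cont t01.
have x'_cont t : t0 < t ->
    {for t, continuous (fun s : R => s * ip (x' s) (x' s))}.
  move=> t0t; have := is_derive_ip Hip (dx' t t0t) (dx' t t0t) => ?.
  exact: is_derive_continuous (is_derive_mult (is_derive_id _ _) _).
have [Q dQ] := exists_antiderivative x'_cont t01.
(* The antiderivatives start at t0 + 1 and are differentiable strictly after it; starting the
   trajectory at t0 + 2 makes everything differentiable on a closed ray. *)
have t1T t : t0 + 2 <= t -> t0 + 1 < t.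
  by apply: lt_le_trans; rewrite ltrD2l ltr1n.
have t0T t : t0 + 2 <= t -> t0 < t by move/t1T; exact: lt_trans.
apply: (inertial_trajectory_cvg Hip Phi_grad Phi_convex Phi_even
  (T := t0 + 2) (alpha := alpha) (g := g) (x' := x') (x'' := x'')
  (P := P) (Q := Q) (Gam := Gam) (BGam := B)) => //.
- by rewrite addr_gt0.
- by move=> t /t0T; exact: dx.
- by move=> t /t0T; exact: dx'.
- by move=> t /t0T/ltW; exact: ode.
- by move=> t /t1T; exact: dP.
- by move=> t /t1T; exact: dQ.
- by move=> t Tt; rewrite -ode ?(ltW (t0T _ Tt)) //; exact: dGam (t1T _ Tt).
- by move=> t /t1T; exact: GamB.
Qed.
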